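(* Let $ABC$ be a (nondegenerate) triangle in the Euclidean plane and let $M$ be the midpoint of $AB$. Suppose there exist a cevian $AA_1$ issuing from $A$ (with $A_1$ on the line $(BC)$) and a cevian $BB_1$ issuing from $B$ (with $B_1$ on the line $(AC)$) such that $|AA_1| = |BB_1|$ and such that the lines $(AA_1)$ and $(BB_1)$ intersect at a point of the median line $(CM)$. Then $ABC$ is isosceles with $AC = BC$.
   Context: A cevian of a triangle is a segment joining a vertex of the triangle to a point that lies on the opposite side or on its extension and is different from the endpoints of that side. $(XY)$ denotes the line through points $X$ and $Y$. *)

(* Defs.v *)
From mathcomp Require Import all_boot all_order all_algebra.
From mathcomp Require Import classical_sets reals.

Set Implicit Arguments.
Unset Strict Implicit.
Unset Printing Implicit Defensive.

Import Order.TTheory GRing.Theory Num.Theory.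

Local Open Scope classical_set_scope.
Local Open Scope ring_scope.

(* The Euclidean plane is ['rV[R]_2] with [edist]; the norm that
   MathComp-Analysis puts on row vectors is the sup norm. *)
Definition edist (R : realType) (X Y : 'rV[R]_2) : R :=
  Num.sqrt (\sum_(i < 2) (X 0 i - Y 0 i) ^+ 2).

(* This is a line only when X and Y are distinct; for X = Y it is {X}. *)
Definition line (R : realType) (X Y : 'rV[R]_2) : set 'rV[R]_2 :=
  [set P | exists t : R, P = X + t *: (Y - X)].

Definition collinear (R : realType) (X Y Z : 'rV[R]_2) : Prop :=
  exists P Q : 'rV[R]_2, [/\ P != Q, line P Q X, line P Q Y & line P Q Z].

Definition midpoint (R : realType) (X Y : 'rV[R]_2) : 'rV[R]_2 :=
  2^-1 *: (X + Y).

(* [cevian_foot Y Z F]: for a triangle X Y Z, the segment XF is a cevian issuing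
   from X.  The foot may lie on an extension of the side YZ. *)
Definition cevian_foot (R : realType) (Y Z F : 'rV[R]_2) : Prop :=
  [/\ line Y Z F, F != Y & F != Z].

(* Main.v *)
Require Import Defs.
From mathcomp Require Import all_boot all_order all_algebra.
From mathcomp Require Import classical_sets reals.
From mathcomp Require Import ring.

(** Take [C] as origin and put [a = A - C], [b = B - C]; these vectors are
    linearly independent because the triangle is nondegenerate
    ([noncollinear_free]).  The feet are [A1 = C + s *: b] and
    [B1 = C + r *: a] with [s] and [r] different from [1].  A common point of
    the two cevian lines has the form [C + k *: (a + b)] when it lies on the
    median, and comparing coordinates in the basis [(a, b)] gives
    [s = r] and [s != -1] ([concurrent_with_median]).  The equality [s = r] is
    the case of a median in Ceva's theorem.  Then
      [|B B1|^2 - |A A1|^2 = (s^2 - 1) * (|A C|^2 - |B C|^2)],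
    and the factor [s^2 - 1] does not vanish. *)

Import Order.TTheory GRing.Theory Num.Theory.

Local Open Scope classical_set_scope.
Local Open Scope ring_scope.

Lemma collinear_scale (R : realType) (A B C : 'rV[R]_2) (c : R) :
  A - C = c *: (B - C) -> collinear A B C.
Proof.
move=> hA; have {hA} eA : A = C + c *: (B - C) by rewrite -hA addrC subrK.
have [eBC | nBC] := eqVneq B C.
  (* The three points coincide, so any line through [C] serves. *)
  have eAC : A = C by rewrite eA eBC subrr scaler0 addr0.
  exists C, (C + const_mx 1); rewrite eBC eAC.
  have onC : line C (C + const_mx 1) C by exists 0; rewrite scale0r addr0.
  split=> //; apply/eqP => /rowP /(_ 0) /eqP.
  by rewrite !mxE addrC -subr_eq subrr eq_sym oner_eq0.
exists C, B; split; first by rewrite eq_sym.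
- by exists c.
- by exists 1; rewrite scale1r addrC subrK.
- by exists 0; rewrite scale0r addr0.
Qed.

Lemma collinear_swap (R : realType) (A B C : 'rV[R]_2) :
  collinear A B C -> collinear B A C.
Proof. by move=> [P [Q [nPQ lA lB lC]]]; exists P, Q. Qed.

Lemma noncollinear_free (R : realType) (A B C : 'rV[R]_2) (x y : R) :
  ~ collinear A B C -> x *: (A - C) + y *: (B - C) = 0 -> x = 0 /\ y = 0.
Proof.
have key X Y (u v : R) : ~ collinear X Y C ->
    u *: (X - C) + v *: (Y - C) = 0 -> u = 0.
  move=> nXY /eqP; rewrite addr_eq0 -scaleNr => /eqP e.
  have [// | nu] := eqVneq u 0; case: nXY.
  apply: (@collinear_scale _ _ _ _ (u^-1 * - v)).
  by rewrite -scalerA -e scalerA mulVf // scale1r.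
move=> nABC e; split; first exact: key nABC e.
rewrite addrC in e; apply: key e => h.
exact/nABC/collinear_swap.
Qed.

Lemma lineC (R : realType) (X Y P : 'rV[R]_2) : line X Y P -> line Y X P.
Proof.
move=> [t ->]; exists (1 - t).
by apply/rowP => i; rewrite !mxE; ring.
Qed.

(** Cevians meeting on the median from [C] cut the sides issuing from [C] in
    the same ratio [s]; the value [-1] of this ratio is excluded because the
    cevian lines would then be parallel. *)
Lemma concurrent_with_median (R : realType) (A B C P : 'rV[R]_2) (s r : R) :
    ~ collinear A B C ->
    line A (C + s *: (B - C)) P -> line B (C + r *: (A - C)) P ->
    line C (midpoint A B) P ->
  s = r /\ s != -1.
Proof.
move=> nABC [p eP] [q eP'] [m eM].
have [e1 e2] : 1 - p - m / 2 = 0 /\ p * s - m / 2 = 0.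
  apply: noncollinear_free nABC _; apply/rowP => i.
  have /rowP/(_ i) := eP; rewrite eM /midpoint !mxE => /eqP.
  by rewrite eq_sym -subr_eq0 => /eqP <-; field.
have [e3 e4] : q * r - m / 2 = 0 /\ 1 - q - m / 2 = 0.
  apply: noncollinear_free nABC _; apply/rowP => i.
  have /rowP/(_ i) := eP'; rewrite eM /midpoint !mxE => /eqP.
  by rewrite eq_sym -subr_eq0 => /eqP <-; field.
have epq : p = q.
  by apply/eqP; rewrite -subr_eq0 -(subrr 0) -{1}e4 -e1; apply/eqP; ring.
have eps : p * (s + 1) = 1.
  transitivity (1 + ((p * s - m / 2) - (1 - p - m / 2))); first by ring.
  by rewrite e1 e2 subrr addr0.
have np : p != 0.
  by apply: contra_eq_neq eps => ->; rewrite mul0r eq_sym oner_eq0.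
split.
  apply: (mulfI np); rewrite {2}epq; apply/eqP; rewrite -subr_eq0.
  by rewrite -(subrr 0) -{1}e2 -e3; apply/eqP; ring.
by apply: contra_eq_neq eps => ->; rewrite addNr mulr0 eq_sym oner_eq0.
Qed.

Lemma eq_edist (R : realType) (X Y Z T : 'rV[R]_2) :
  edist X Y = edist Z T <->
  \sum_(i < 2) (X 0 i - Y 0 i) ^+ 2 = \sum_(i < 2) (Z 0 i - T 0 i) ^+ 2.
Proof.
rewrite /edist; split=> [/eqP | -> //].
by rewrite eqr_sqrt ?sumr_ge0 // => [/eqP | i _ | i _]; rewrite ?sqr_ge0.
Qed.

Theorem mainTheorem2 (R : realType) (A B C M : 'rV[R]_2)
    (hABC : ~ collinear A B C) (hM : M = midpoint A B)
    (hcev : exists A1 B1 : 'rV[R]_2,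
      [/\ cevian_foot B C A1,
          cevian_foot A C B1,
          edist A A1 = edist B B1 &
          exists P : 'rV[R]_2,
            [/\ line A A1 P, line B B1 P & line C M P]]) :
  edist A C = edist B C.
Proof.
case: hcev => A1 [B1 [[/lineC[s eA1] nA1B _] [/lineC[r eB1] _ _] hd]].
move=> [P [lA lB lM]]; subst A1 B1 M.
have [ers ns1] := concurrent_with_median _ _ _ _ _ _ _ hABC lA lB lM; subst r.
have s1 : s != 1.
  by apply: contraNneq nA1B => ->; rewrite scale1r addrC subrK.
have ns : s ^+ 2 - 1 != 0 by rewrite subr_eq0 sqrf_eq1 negb_or s1.
move/eq_edist/eqP: hd; rewrite eq_sym -subr_eq0 => /eqP hd.
apply/eq_edist/eqP; rewrite -subr_eq0 -(mulrI_eq0 _ (mulfI ns)) -hd.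
by rewrite !big_ord_recl !big_ord0 !mxE; apply/eqP; ring.
Qed.
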